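(* Let $\beta$ be a positive braid word, and let $B_\beta$ be the extended exchange matrix of the right inductive weave $\overrightarrow{\mathfrak W}(\beta)$ (equivalently of the seed $\overrightarrow{\mathbf s}_t(\beta)$). Then $(\Lambda_\beta,B_\beta)$ is a compatible pair; equivalently, $$(-\Lambda_\beta)B_\beta=2I$$ on the exchangeable columns, i.e. $\bigl((-\Lambda_\beta)B_\beta\bigr)_{u,v}=2\delta_{u,v}$ for every $u\in V_\beta$ and every exchangeable $v\in V_\beta$.
   Context: **Words.** $C=(c_{ij})_{i,j\in I}$ is a Cartan matrix of finite simply-laced type, $W$ its Weyl group (simple reflections $s_i$), $\alpha_i,\alpha_i^\vee$ simple roots and coroots, $(\alpha_i,\alpha_j)=c_{ij}$. A positive braid word is a finite sequence $\beta=(i_1,\dots,i_r)$ in $I$. Demazure product: $\delta(\varnothing)=e$, $\delta(\beta i)=\max\{\delta(\beta),\delta(\beta)s_i\}$ (Bruhat order). With $\beta_k=(i_1,\dots,i_k)$, position $k$ is solid if $\delta(\beta_k)=\delta(\beta_{k-1})$. **Right inductive weave.** A Demazure weave $\beta\to\delta(\beta)$ is a downward planar graph with edges coloured by $I$, top boundary word $\beta$, bottom boundary a reduced word of $\delta(\beta)$, and vertices: four-valent ($ik\to ki$, $c_{ik}=0$), six-valent ($iji\to jij$, $c_{ij}=-1$), trivalent ($ii\to i$). Incoming edges at $v$, left to right, are $e_{v,\rm nw},(e_{v,\rm n}),e_{v,\rm ne}$; outgoing ones $e_{v,\rm sw},e_{v,\rm s},e_{v,\rm se}$ (only $e_{v,\rm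 s}$ if trivalent). $\overrightarrow{\mathfrak W}(\beta)$ is built by inserting $i_1,\dots,i_r$ successively on the right: if $k$ is not solid adjoin an $i_k$-strand on the right; if $k$ is solid, use four-/six-valent vertices to make the current reduced bottom word end in $i_k$, then merge its last strand ($e_{v,\rm nw}$) with the new strand ($e_{v,\rm ne}$) at a trivalent vertex $v$. $V_\beta=\{v_1<\dots<v_N\}$ is the set of trivalent vertices, in bijection $v\mapsto q_v$ with solid positions; $u<v$ iff $q_u<q_v$. **Cycles.** The Lusztig cycle $\gamma_v$ is the function from edges to $\mathbb Z_{\ge0}$ that vanishes above $v$, equals $1$ on $e_{v,\rm s}$, and propagates below $v$ by: trivalent: $\gamma(e_{\rm s})=\min(\gamma(e_{\rm nw}),\gamma(e_{\rm ne}))$; four-valent: $\gamma(e_{\rm sw})=\gamma(e_{\rm ne})$, $\gamma(e_{\rm se})=\gamma(e_{\rm nw})$; six-valent, with $m=\min(\gamma(e_{\rm nw}),\gamma(e_{\rm ne}))$: $\gamma(e_{\rm sw})=\gamma(e_{\rm n})+\gamma(e_{\rm ne})-m$, $\gamma(e_{\rm s})=m$, $\gamma(e_{\rm se})=\gamma(e_{\rm nw})+\gamma(e_{\rm n})-m$. $v$ is frozen if $\gamma_v\neq0$ on some bottom edge, and exchangeable otherwise; $V_{\beta,\rm ex}$ is the set of exchangeable vertices. **Exchange matrix.** For cycles $C,C'$: at a trivalent vertex with weights $(a_1,a',a_2)$, $(b_1,b',b_2)$ on (nw, s, ne), the local intersection is $\det\begin{pmatrix}1&1&1\\ a_1&a'&a_2\\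 b_1&b'&b_2\end{pmatrix}$; at a six-valent vertex with incoming weights $(a_1,a_2,a_3),(b_1,b_2,b_3)$ and outgoing weights $(a_1',a_2',a_3'),(b_1',b_2',b_3')$ (left to right) it is $\frac12\left[\det\begin{pmatrix}1&1&1\\ a_1&a_2&a_3\\ b_1&b_2&b_3\end{pmatrix}-\det\begin{pmatrix}1&1&1\\ a_1'&a_2'&a_3'\\ b_1'&b_2'&b_3'\end{pmatrix}\right]$; four-valent vertices contribute $0$. If the bottom word is $(h_1,\dots,h_m)$ with weights $c_k,c_k'$, the boundary term is $\frac12\sum_{k,l}\operatorname{sgn}(l-k)c_kc'_l\langle\rho_k,\rho_l^\vee\rangle$, where $\rho_k=s_{h_1}\cdots s_{h_{k-1}}(\alpha_{h_k})$, $\rho_k^\vee=s_{h_1}\cdots s_{h_{k-1}}(\alpha^\vee_{h_k})$. $\varepsilon_{u,v}$ is the sum of all local intersections of $(\gamma_u,\gamma_v)$ plus the boundary term; $B_\beta=(b_{u,v})_{u\in V_\beta,v\in V_{\beta,\rm ex}}$ with $b_{u,v}=\varepsilon_{v,u}$. **The form.** $A_\beta=(a_{ij})_{1\le i,j\le N}$ is the strictly upper triangular matrix with $a_{ij}=\gamma_{v_i}(e_{v_j,\rm nw})$ for $i<j$ and $0$ otherwise. With $\alpha_k^\beta=s_{i_1}\cdots s_{i_{k-1}}(\alpha_{i_k})$, put $\lambda^\beta_{a,b}=(\alpha_a^\beta,\alpha_b^\beta)$ for $a<b$, $0$ for $a=b$, $-(\alpha_a^\beta,\alpha_b^\beta)$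 for $a>b$, and $\widehat L^\beta=(\lambda^\beta_{q_{v_i},q_{v_j}})_{1\le i,j\le N}$. Then $\Lambda_\beta:=(I_N-A_\beta)^{-\mathsf T}\,\widehat L^\beta\,(I_N-A_\beta)^{-1}$, with rows and columns indexed by $V_\beta$. Compatible pair: $\sum_{u}b_{u,v}(\Lambda_\beta)_{u,w}=2\delta_{v,w}$ for $v\in V_{\beta,\rm ex}$, $w\in V_\beta$. *)

(* Defs.v *)
From Stdlib Require Import Relation_Operators.
From mathcomp Require Import all_boot all_order all_algebra.
From mathcomp Require Import boolp.

Set Implicit Arguments.
Unset Strict Implicit.
Unset Printing Implicit Defensive.

Import Order.TTheory GRing.Theory Num.Theory.
Local Open Scope ring_scope.

(* The index set I is 'I_n; letters and positions of words are counted from 0. *)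

Definition simply_laced_finite_type (n : nat) (C : 'M[int]_n) : Prop :=
  [/\ forall i, C i i = 2,
      forall i j, i != j -> C i j = 0 \/ C i j = -1,
      C^T = C
    & forall x : 'cV[rat]_n, x != 0 ->
        0 < (x^T *m map_mx intr C *m x) ord0 ord0].

(* The root and coroot lattices are both Z^n, written as column vectors in the
   basis of simple roots (resp. coroots); [C i j] = <alpha_j, alpha_i^vee>. *)

Definition simple (n : nat) (i : 'I_n) : 'cV[int]_n := delta_mx i ord0.

Definition root_form (n : nat) (C : 'M[int]_n) (x y : 'cV[int]_n) : int :=
  (x^T *m C *m y) ord0 ord0.

Definition pairing (n : nat) (C : 'M[int]_n) (x y : 'cV[int]_n) : int :=
  (y^T *m C *m x) ord0 ord0.

(* s_i (alpha_j) = alpha_j - C i j *: alpha_i.  The action of s_i on coroots is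
   [refl C^T i]. *)
Definition refl (n : nat) (C : 'M[int]_n) (i : 'I_n) : 'M[int]_n :=
  1%:M - simple i *m (simple i)^T *m C.

(* Elements of the Weyl group are the matrices [wprod C w] of their (faithful)
   action on the root lattice. *)
Definition wprod (n : nat) (C : 'M[int]_n) (w : seq 'I_n) : 'M[int]_n :=
  foldr (fun i g => refl C i *m g) 1%:M w.

(* s_{w_0} ... s_{w_(k-1)} (alpha_{w_k}) *)
Definition word_root (n : nat) (C : 'M[int]_n) (w : seq 'I_n) (k : nat) :
    'cV[int]_n :=
  wprod C (take k w) *m nth 0 [seq simple i | i <- w] k.

Definition word_coroot (n : nat) (C : 'M[int]_n) (w : seq 'I_n) (k : nat) :
    'cV[int]_n :=
  word_root C^T w k.

Definition reduced (n : nat) (C : 'M[int]_n) (w : seq 'I_n) : bool :=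
  [forall k : 'I_(size w), forall w' : k.-tuple 'I_n, wprod C w' != wprod C w].

Definition has_length (n : nat) (C : 'M[int]_n) (g : 'M[int]_n) (l : nat) :
    Prop :=
  exists w, [/\ wprod C w = g, reduced C w & size w = l].

Definition is_reflection (n : nat) (C : 'M[int]_n) (t : 'M[int]_n) : Prop :=
  exists x i, t = wprod C (x ++ i :: rev x).

Definition bruhat_step (n : nat) (C : 'M[int]_n) (g g' : 'M[int]_n) : Prop :=
  (exists2 t, is_reflection C t & g' = g *m t) /\
  exists l l', [/\ has_length C g l, has_length C g' l' & (l < l')%N].

Definition bruhat (n : nat) (C : 'M[int]_n) (g g' : 'M[int]_n) : Prop :=
  clos_refl_trans _ (bruhat_step C) g g'.

(* Only applied to Bruhat-comparable elements. *)
Definition bruhat_max (n : nat) (C : 'M[int]_n) (g g' : 'M[int]_n) :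
    'M[int]_n :=
  if `[< bruhat C g g' >] then g' else g.

Definition demazure (n : nat) (C : 'M[int]_n) (b : seq 'I_n) : 'M[int]_n :=
  foldl (fun g i => bruhat_max C g (g *m refl C i)) 1%:M b.

Definition solid (n : nat) (C : 'M[int]_n) (b : seq 'I_n) (k : nat) : bool :=
  demazure C (take k.+1 b) == demazure C (take k b).

Definition solids (n : nat) (C : 'M[int]_n) (b : seq 'I_n) : seq nat :=
  [seq k <- iota 0 (size b) | solid C b k].

(* A weave is cut by horizontal lines into slices containing one vertex each.
   It is then the list of its vertices from top to bottom, a vertex being given
   by its valency and by the position, among the strands crossing the line just
   above it, of its leftmost incoming edge. *)
Inductive vertex := Tri of nat | Four of nat | Six of nat.

Definition vpos (v : vertex) : nat :=
  match v with Tri p | Four p | Six p => p end.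

Definition trivalent (v : vertex) : bool := if v is Tri _ then true else false.

Inductive slice (n : nat) (C : 'M[int]_n) :
    seq 'I_n -> vertex -> seq 'I_n -> Prop :=
| SliceTri x y i :
    slice C (x ++ [:: i; i] ++ y) (Tri (size x)) (x ++ [:: i] ++ y)
| SliceFour x y i k : C i k = 0 ->
    slice C (x ++ [:: i; k] ++ y) (Four (size x)) (x ++ [:: k; i] ++ y)
| SliceSix x y i j : C i j = -1 ->
    slice C (x ++ [:: i; j; i] ++ y) (Six (size x)) (x ++ [:: j; i; j] ++ y).

(* [weave C b om h]: [om] is a weave with top word [b] and bottom word [h]. *)
Inductive weave (n : nat) (C : 'M[int]_n) :
    seq 'I_n -> seq vertex -> seq 'I_n -> Prop :=
| WeaveNil b : weave C b [::] b
| WeaveCons b v b' om h :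
    slice C b v b' -> weave C b' om h -> weave C b (v :: om) h.

(* [right_inductive C b om h]: [om] is a right inductive weave of [b], with
   bottom word [h]; all choices of the four- and six-valent vertices [mu] are
   allowed.  Letters not yet inserted are vertical strands on the right, so
   adjoining a strand does not change the list of vertices. *)
Inductive right_inductive (n : nat) (C : 'M[int]_n) :
    seq 'I_n -> seq vertex -> seq 'I_n -> Prop :=
| RightNil : right_inductive C [::] [::] [::]
| RightAdjoin b om h i :
    right_inductive C b om h ->
    ~~ solid C (rcons b i) (size b) ->
    right_inductive C (rcons b i) om (rcons h i)
| RightMerge b om h i mu h' :
    right_inductive C b om h ->
    solid C (rcons b i) (size b) ->
    weave C h mu (rcons h' i) -> ~~ has trivalent mu ->
    right_inductive C (rcons b i) (om ++ rcons mu (Tri (size h'))) (rcons h' i).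

Lemma weave_rcons (n : nat) (C : 'M[int]_n) b om h i :
  weave C b om h -> weave C (rcons b i) om (rcons h i).
Proof.
elim=> [b0|b0 v b1 om0 h0 sl _ IH]; first exact: WeaveNil.
apply: WeaveCons IH; case: {b0 b1} sl => [x y j|x y j k e|x y j k e];
  by rewrite !rcons_cat /=; constructor.
Qed.

Lemma weave_cat (n : nat) (C : 'M[int]_n) b om h om' h' :
  weave C b om h -> weave C h om' h' -> weave C b (om ++ om') h'.
Proof. by elim=> // b0 v b1 om0 h0 sl _ IH /IH; apply: WeaveCons. Qed.

Lemma right_inductive_weave (n : nat) (C : 'M[int]_n) b om h :
  right_inductive C b om h -> weave C b om h.
Proof.
elim=> [|b0 om0 h0 i _ IH _|b0 om0 h0 i mu h' _ IH _ wmu _].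
- exact: WeaveNil.
- exact: weave_rcons.
apply: (weave_cat (weave_rcons i IH)); rewrite -(cats1 mu).
apply: (weave_cat (weave_rcons i wmu)); apply: WeaveCons (WeaveNil _ _).
by have := SliceTri C h' [::] i; rewrite -!cats1 -!catA.
Qed.

(* A cycle is a weight on edges.  It is recorded by the list of the weights of
   the strands crossing each horizontal line, from left to right. *)
Definition propagate (v : vertex) (a : seq nat) : seq nat :=
  let e := nth 0%N a in
  match v with
  | Tri p => take p a ++ [:: minn (e p) (e p.+1)] ++ drop p.+2 a
  | Four p => take p a ++ [:: e p.+1; e p] ++ drop p.+2 a
  | Six p =>
      let m := minn (e p) (e p.+2) in
      take p a ++ [:: (e p.+1 + e p.+2 - m)%N; m; (e p + e p.+1 - m)%N]
        ++ drop p.+3 a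
  end.

(* [lusztig r om k t] is the list of weights, on the line above the [t]-th
   vertex, of the Lusztig cycle of the (trivalent) [k]-th vertex of [om]; [r]
   is the length of the top word.  The bottom edges are the case
   [t = size om]. *)
Fixpoint lusztig (r : nat) (om : seq vertex) (k t : nat) : seq nat :=
  if t is t'.+1 then
    let v := nth (Tri 0) om t' in
    let a := propagate v (lusztig r om k t') in
    if t' == k then set_nth 0%N a (vpos v) 1%N else a
  else nseq r 0%N.

Definition trivalents (om : seq vertex) : seq nat :=
  [seq t <- iota 0 (size om) | trivalent (nth (Tri 0) om t)].

(* V_beta, in increasing order: the element v_i is represented by i : 'I_N. *)
Definition nV (om : seq vertex) : nat := size (trivalents om).

Definition gamma (n : nat) (b : seq 'I_n) (om : seq vertex) (i : 'I_(nV om))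
    (t : nat) : seq nat :=
  lusztig (size b) om (nth 0%N (trivalents om) i) t.

Definition exchangeable (n : nat) (b : seq 'I_n) (om : seq vertex) :
    {set 'I_(nV om)} :=
  [set i | all (fun c => c == 0%N) (gamma b i (size om))].

Definition det3 (a b : seq nat) : rat :=
  \det (\matrix_(i < 3, j < 3)
          (nth 0%N (nth [::] [:: [:: 1%N; 1%N; 1%N]; a; b] i) j)%:R).

(* [a], [b] (resp. [a'], [b']) are the weights of the two cycles on the line
   just above (resp. just below) the vertex [v]. *)
Definition local_intersection (v : vertex) (a a' b b' : seq nat) : rat :=
  let tri p (c c' : seq nat) :=
    [:: nth 0%N c p; nth 0%N c' p; nth 0%N c p.+1] in
  let six p (c : seq nat) :=
    [:: nth 0%N c p; nth 0%N c p.+1; nth 0%N c p.+2] in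
  match v with
  | Tri p => det3 (tri p a a') (tri p b b')
  | Four _ => 0
  | Six p => (det3 (six p a) (six p b) - det3 (six p a') (six p b')) / 2
  end.

Definition boundary_intersection (n : nat) (C : 'M[int]_n) (h : seq 'I_n)
    (c c' : seq nat) : rat :=
  (\sum_(k < size h) \sum_(l < size h)
     Num.sg (l%:R - k%:R) * (nth 0%N c k)%:R * (nth 0%N c' l)%:R
       * (pairing C (word_root C h k) (word_coroot C h l))%:~R) / 2.

Definition epsilon (n : nat) (C : 'M[int]_n) (b : seq 'I_n) (om : seq vertex)
    (h : seq 'I_n) (u v : 'I_(nV om)) : rat :=
  \sum_(t < size om)
     local_intersection (nth (Tri 0) om t)
       (gamma b u t) (gamma b u t.+1) (gamma b v t) (gamma b v t.+1)
  + boundary_intersection C h (gamma b u (size om)) (gamma b v (size om)).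

(* The columns are indexed by the enumeration of the exchangeable vertices. *)
Definition exchange_matrix (n : nat) (C : 'M[int]_n) (b : seq 'I_n)
    (om : seq vertex) (h : seq 'I_n) : 'M[rat]_(nV om, #|exchangeable b om|) :=
  \matrix_(u, v) epsilon C b h (enum_val v) u.

Definition A_matrix (n : nat) (b : seq 'I_n) (om : seq vertex) :
    'M[rat]_(nV om) :=
  \matrix_(i, j)
    if (i < j)%N then
      let t := nth 0%N (trivalents om) j in
      (nth 0%N (gamma b i t) (vpos (nth (Tri 0) om t)))%:R
    else 0.

Definition lambda_form (n : nat) (C : 'M[int]_n) (b : seq 'I_n) (k l : nat) :
    rat :=
  Num.sg (l%:R - k%:R) * (root_form C (word_root C b k) (word_root C b l))%:~R.

(* The order-preserving bijection v |-> q_v sends v_i to the i-th solid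
   position. *)
Definition L_matrix (n : nat) (C : 'M[int]_n) (b : seq 'I_n)
    (om : seq vertex) : 'M[rat]_(nV om) :=
  \matrix_(i, j) lambda_form C b (nth 0%N (solids C b) i) (nth 0%N (solids C b) j).

Definition Lambda_matrix (n : nat) (C : 'M[int]_n) (b : seq 'I_n)
    (om : seq vertex) : 'M[rat]_(nV om) :=
  let M := invmx (1%:M - A_matrix b om) in
  M^T *m L_matrix C b om *m M.

Definition compatible_pair (N : nat) (X : {set 'I_N}) (L : 'M[rat]_N)
    (B : 'M[rat]_(N, #|X|)) : Prop :=
  forall (v : 'I_#|X|) (w : 'I_N),
    \sum_u B u v * L u w = 2 * (enum_val v == w)%:R.

(* Main.v *)
(* The roots [rho_k] of the strands of a slice turn a cycle with weights [c_k]
   into the vector [sum c_k rho_k].  At a four- or six-valent vertex this vector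
   does not change, and the local intersection compensates the change of the
   boundary term.  In a right inductive weave the strand inserted from the right
   has weight 0, so that the j-th trivalent vertex kills the weight [A_uj] of the
   older cycles and starts a new cycle at the root [R_j] of its incoming left
   strand.  Hence, with [M = I - A], the vector of [gamma_u] at the bottom is
   [sum_j M_uj R_j], and telescoping gives [epsilon = 1/2 M (V - V^T) M^T] where
   [V] is the upper unitriangular matrix with [V + V^T = ((R_i, R_j))].

   On the other side, the roots [alpha_q] of the word at the solid positions are
   obtained from the [R_j] by successive reflections, which amounts to
   [R = - alpha V]; so [alpha] has Gram matrix [V^-1 + V^-T], and
   [L = V^-1 - V^-T].  If [v] is exchangeable, its bottom vector vanishes, so
   that [M_v (V + V^T) = 0], and
   [epsilon_v M^-T L M^-1 = 1/2 M_v (V - V^T) (V^-1 - V^-T) M^-1 = 2 e_v]. *)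

Require Import Defs.
From mathcomp Require Import all_boot all_order all_algebra.
From mathcomp Require Import ring lra zify boolp.

Set Implicit Arguments.
Unset Strict Implicit.
Unset Printing Implicit Defensive.

Import Order.TTheory GRing.Theory Num.Theory.
Local Open Scope ring_scope.

(** * Rational roots and the invariant form *)

Section RationalRoots.

Variables (n : nat) (C : 'M[int]_n).

Definition qform (x y : 'cV[rat]_n) : rat :=
  (x^T *m map_mx intr C *m y) ord0 ord0.

Definition qsimple (i : 'I_n) : 'cV[rat]_n := map_mx intr (simple i).
Definition qrefl (i : 'I_n) : 'M[rat]_n := map_mx intr (refl C i).
Definition qprod (w : seq 'I_n) : 'M[rat]_n := map_mx intr (wprod C w).
Definition qroot (w : seq 'I_n) (k : nat) : 'cV[rat]_n :=
  map_mx intr (word_root C w k).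

Lemma qformDl x y z : qform (x + y) z = qform x z + qform y z.
Proof. by rewrite /qform linearD !mulmxDl mxE. Qed.

Lemma qformDr x y z : qform z (x + y) = qform z x + qform z y.
Proof. by rewrite /qform !mulmxDr mxE. Qed.

Lemma qformZl a x y : qform (a *: x) y = a * qform x y.
Proof. by rewrite /qform linearZ -!scalemxAl mxE. Qed.

Lemma qformZr a x y : qform x (a *: y) = a * qform x y.
Proof. by rewrite /qform -!scalemxAr mxE. Qed.

Lemma qform0l x : qform 0 x = 0.
Proof. by rewrite -(scale0r 0) qformZl mul0r. Qed.

Lemma qform0r x : qform x 0 = 0.
Proof. by rewrite -(scale0r 0) qformZr mul0r. Qed.

Lemma qformNl x y : qform (- x) y = - qform x y.
Proof. by rewrite -scaleN1r qformZl mulN1r. Qed.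

Lemma qformNr x y : qform x (- y) = - qform x y.
Proof. by rewrite -scaleN1r qformZr mulN1r. Qed.

Lemma qform_suml I (r : seq I) (F : I -> 'cV_n) y :
  qform (\sum_(i <- r) F i) y = \sum_(i <- r) qform (F i) y.
Proof.
exact: (big_morph (fun x => qform x y) (fun x z => qformDl x z y) (qform0l y)).
Qed.

Lemma qform_sumr I (r : seq I) (F : I -> 'cV_n) x :
  qform x (\sum_(i <- r) F i) = \sum_(i <- r) qform x (F i).
Proof.
exact: (big_morph (qform x) (fun y z => qformDr y z x) (qform0r x)).
Qed.

Lemma qform_map (x y : 'cV[int]_n) :
  qform (map_mx intr x) (map_mx intr y) = (root_form C x y)%:~R.
Proof. by rewrite /qform /root_form map_trmx -!map_mxM mxE. Qed.

Lemma root_form_simple i j : root_form C (simple i) (simple j) = C i j.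
Proof.
by rewrite /root_form /simple trmx_delta -rowE -colE !mxE.
Qed.

Lemma qform_simple i j : qform (qsimple i) (qsimple j) = (C i j)%:~R.
Proof. by rewrite qform_map root_form_simple. Qed.

Lemma qrefl_act i x :
  qrefl i *m x = x - qform (qsimple i) x *: qsimple i.
Proof.
rewrite /qrefl /refl map_mxB map_mx1 !map_mxM -map_trmx mulmxBl mul1mx.
rewrite -!mulmxA [X in _ - _ *m X]mx11_scalar mul_mx_scalar.
by rewrite /qform !mulmxA.
Qed.

Lemma qprod_cons i w : qprod (i :: w) = qrefl i *m qprod w.
Proof. by rewrite /qprod /= map_mxM. Qed.

Lemma qprod_nil : qprod [::] = 1%:M.
Proof. by rewrite /qprod map_mx1. Qed.

Lemma qprod_cat x y : qprod (x ++ y) = qprod x *m qprod y.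
Proof.
elim: x => [|i x IH]; first by rewrite qprod_nil mul1mx.
by rewrite cat_cons !qprod_cons IH mulmxA.
Qed.

Lemma qprod_rcons w i : qprod (rcons w i) = qprod w *m qrefl i.
Proof.
by rewrite -cats1 qprod_cat qprod_cons qprod_nil mulmx1.
Qed.

Lemma qroot_catl x y k :
  (k < size x)%N -> qroot (x ++ y) k = qroot x k.
Proof.
move=> kx; rewrite /qroot /word_root take_cat kx map_cat.
by rewrite nth_cat size_map kx.
Qed.

Lemma qroot_rcons w i : qroot (rcons w i) (size w) = qprod w *m qsimple i.
Proof.
rewrite /qroot /word_root -cats1 take_size_cat // map_mxM.
by rewrite map_cat nth_cat size_map ltnn subnn.
Qed.

Lemma qroot_catr x y k : qroot (x ++ y) (size x + k) = qprod x *m qroot y k.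
Proof.
rewrite /qroot /word_root takeD take_size_cat // drop_size_cat //.
rewrite map_cat nth_cat size_map ltnNge leq_addr /= addKn.
by rewrite !map_mxM mulmxA -[map_mx _ (wprod C (x ++ _))]/(qprod _) qprod_cat.
Qed.

Hypotheses (Cdiag : forall i, C i i = 2) (Csym : C^T = C).

Lemma qformC x y : qform x y = qform y x.
Proof.
have trE (M : 'M[rat]_1) : M ord0 ord0 = M^T ord0 ord0 by rewrite mxE.
by rewrite /qform trE !trmx_mul trmxK map_trmx Csym mulmxA.
Qed.

Lemma qrefl_iso i x y : qform (qrefl i *m x) (qrefl i *m y) = qform x y.
Proof.
rewrite !qrefl_act !(qformDl, qformDr, qformNl, qformNr, qformZl, qformZr).
by rewrite qform_simple Cdiag (qformC x (qsimple i)); ring.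
Qed.

Lemma qprod_iso w x y : qform (qprod w *m x) (qprod w *m y) = qform x y.
Proof.
elim: w x y => [|i w IH] x y; first by rewrite qprod_nil !mul1mx.
by rewrite qprod_cons -!mulmxA qrefl_iso IH.
Qed.

Lemma qrefl_simple i j :
  qrefl i *m qsimple j = qsimple j - (C i j)%:~R *: qsimple i.
Proof. by rewrite qrefl_act qform_simple. Qed.

Lemma mulmx_inj_l m (A B : 'M[rat]_(m, n)) :
  (forall x : 'cV_n, A *m x = B *m x) -> A = B.
Proof.
move=> eqAB; apply/matrixP => i j.
by move/matrixP/(_ i ord0): (eqAB (delta_mx j ord0)); rewrite -!colE !mxE.
Qed.

Lemma qprod_four i k : C i k = 0 -> qprod [:: i; k] = qprod [:: k; i].
Proof.
move=> Cik; have Cki : C k i = 0 by rewrite -Csym mxE.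
rewrite !qprod_cons qprod_nil !mulmx1; apply: mulmx_inj_l => x.
rewrite -!mulmxA !qrefl_act !(qformDr, qformNr, qformZr) !qform_simple Cik Cki.
by apply/matrixP => a b; rewrite !mxE; ring.
Qed.

Lemma qprod_six i j :
  C i j = -1 -> qprod [:: i; j; i] = qprod [:: j; i; j].
Proof.
move=> Cij; have Cji : C j i = -1 by rewrite -Csym mxE.
rewrite !qprod_cons qprod_nil !mulmx1; apply: mulmx_inj_l => x.
rewrite -!mulmxA !qrefl_act !(qformDr, qformNr, qformZr) !qform_simple.
rewrite Cij Cji !Cdiag.
by apply/matrixP => a b; rewrite !mxE; ring.
Qed.

End RationalRoots.

(** * Cycles along four- and six-valent vertices *)

Section SkewForm.

Variables (n : nat) (C : 'M[int]_n).
Hypothesis Csym : C^T = C.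

Implicit Types (m p : nat) (x y : nat -> rat) (r : nat -> 'cV[rat]_n).

Definition qsum m x r : 'cV[rat]_n := \sum_(k < m) x k *: r k.

(** For the roots of a word this is the boundary term of two cycles. For the merge roots, with rows
    of [I - A] as coefficients, it is the closed form that the full pairing will take. *)
Definition skew_sum m x y r : rat :=
  (\sum_(k < m) \sum_(l < m)
     Num.sg (l%:R - k%:R) * x k * y l * qform C (r k) (r l)) / 2.

Lemma qsumS m x r : qsum m.+1 x r = qsum m x r + x m *: r m.
Proof. by rewrite /qsum big_ord_recr. Qed.

Lemma eq_qsum m x x' r r' :
    (forall k, (k < m)%N -> x k = x' k) ->
    (forall k, (k < m)%N -> r k = r' k) ->
  qsum m x r = qsum m x' r'.
Proof. by move=> ex er; apply: eq_bigr => k _; rewrite ex ?er. Qed.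

Lemma eq_skew_sum m x x' y y' r r' :
    (forall k, (k < m)%N -> x k = x' k) ->
    (forall k, (k < m)%N -> y k = y' k) ->
    (forall k, (k < m)%N -> r k = r' k) ->
  skew_sum m x y r = skew_sum m x' y' r'.
Proof.
move=> ex ey er; congr (_ / _).
by apply: eq_bigr => k _; apply: eq_bigr => l _; rewrite ex ?ey ?er.
Qed.

Lemma skew_sum0 x y r : skew_sum 0 x y r = 0.
Proof. by rewrite /skew_sum big_ord0 mul0r. Qed.

(** The last index is preceded by all others, so its column enters with sign 1 and its row with sign
    -1, while the diagonal term has sign 0. *)
Lemma skew_sumS m x y r :
  skew_sum m.+1 x y r = skew_sum m x y r
    + (y m * qform C (qsum m x r) (r m) - x m * qform C (qsum m y r) (r m)) / 2.
Proof.
rewrite /skew_sum big_ord_recr /= -mulrDl; congr (_ / _).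
under eq_bigr do rewrite big_ord_recr /=.
rewrite big_split /= -!addrA; congr (_ + _).
rewrite big_ord_recr /= subrr sgr0 !mul0r addr0 !qform_suml.
rewrite !mulr_sumr -sumrN; congr (_ + _); apply: eq_bigr => k _.
  have -> : Num.sg (m%:R - k%:R : rat) = 1.
    by apply/eqP; rewrite sgr_cp0 subr_gt0 ltr_nat.
  by rewrite qformZl mul1r mulrA (mulrC (y m)).
have -> : Num.sg (k%:R - m%:R : rat) = -1.
  by apply/eqP; rewrite sgr_cp0 subr_lt0 ltr_nat.
by rewrite qformZl (qformC Csym (r m)); ring.
Qed.

Lemma skew_sum_anti m x y r : skew_sum m x y r = - skew_sum m y x r.
Proof.
elim: m => [|m IH]; first by rewrite !skew_sum0 oppr0.
by rewrite !skew_sumS IH; field.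
Qed.

Lemma qsumD p d x r :
  qsum (p + d) x r
  = qsum p x r + qsum d (fun k => x (p + k)%N) (fun k => r (p + k)%N).
Proof. by rewrite /qsum big_split_ord. Qed.

(** Every index of the first block precedes every index of the second. All cross terms thus carry a
    sign fixed by the blocks, and the blocks interact only through their vectors [qsum]. *)
Lemma skew_sumD p d x y r :
  let s T (z : nat -> T) := fun k => z (p + k)%N in
  skew_sum (p + d) x y r = skew_sum p x y r + skew_sum d (s _ x) (s _ y) (s _ r)
    + (qform C (qsum p x r) (qsum d (s _ y) (s _ r))
       - qform C (qsum d (s _ x) (s _ r)) (qsum p y r)) / 2.
Proof.
elim: d => [|d IH] /=.
  by rewrite addn0 skew_sum0 /qsum !big_ord0 qform0l qform0r; ring.
rewrite addnS !skew_sumS IH !qsumS !qsumD /=.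
rewrite !(qformDl, qformDr, qformZl, qformZr).
by rewrite (qformC Csym (r (p + d)%N) (qsum p y r)); field.
Qed.

End SkewForm.

(** * Local intersections and downward propagation of weights *)

Definition weight (a : seq nat) (k : nat) : rat := (nth 0%N a k)%:R.

Lemma det3E (a b : seq nat) :
  det3 a b = (weight a 1 * weight b 2 - weight a 2 * weight b 1)
    - (weight a 0 * weight b 2 - weight a 2 * weight b 0)
    + (weight a 0 * weight b 1 - weight a 1 * weight b 0).
Proof.
rewrite /det3 (expand_det_row _ ord0) !big_ord_recl big_ord0 /cofactor.
rewrite !(expand_det_row _ (ord0 : 'I_2)) !big_ord_recl !big_ord0 /cofactor.
by rewrite !det_mx11 !mxE /= /weight; ring.
Qed.

Lemma local_intersection_six p a a' b b' :
  local_intersection (Six p) a a' b b'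
  = (det3 (drop p a) (drop p b) - det3 (drop p a') (drop p b')) / 2.
Proof. by rewrite /= !det3E /weight !nth_drop /= ?addn0 ?addn1 ?addn2. Qed.

Lemma local_intersection_anti v a a' b b' :
  local_intersection v a a' b b' = - local_intersection v b b' a a'.
Proof.
by case: v => p /=; rewrite ?oppr0 // !det3E; [ring | field].
Qed.

(** In contrast with [lusztig], the weights start from arbitrary lists and no vertex of [om] creates
    a cycle. This describes cycles that were all born above [om]. *)
Fixpoint flow_intersection (om : seq vertex) (a b : seq nat) : rat :=
  if om is v :: om' then
    local_intersection v a (propagate v a) b (propagate v b)
    + flow_intersection om' (propagate v a) (propagate v b)
  else 0.

Definition flow (om : seq vertex) (a : seq nat) : seq nat :=
  foldl (fun a v => propagate v a) a om.

Lemma size_propagate n (C : 'M[int]_n) w v w' a :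
  slice C w v w' -> size a = size w -> size (propagate v a) = size w'.
Proof.
case=> [x y i|x y i k _|x y i j _] sa; move: sa;
  rewrite !size_cat /= ?size_cat /= ?size_take ?size_drop => sa.
all: try by case: ltnP; lia.
Qed.

Lemma size_flow n (C : 'M[int]_n) w om w' a :
  weave C w om w' -> size a = size w -> size (flow om a) = size w'.
Proof.
move=> wv; elim: wv a => //= w0 v w1 om0 h0 sl _ IH a sa.
exact: IH (size_propagate sl sa).
Qed.

(** * Conservation of vectors and pairings at vertices that are not trivalent *)

Section Braid.

Variables (n : nat) (C : 'M[int]_n).
Hypotheses (Cdiag : forall i, C i i = 2) (Csym : C^T = C).

Definition wsum (w : seq 'I_n) (a : seq nat) : 'cV[rat]_n :=
  qsum (size w) (weight a) (qroot C w).

Definition wskew (w : seq 'I_n) (a b : seq nat) : rat :=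
  skew_sum C (size w) (weight a) (weight b) (qroot C w).

Lemma wsum_cat u v a :
  wsum (u ++ v) a = wsum u a + qprod C u *m wsum v (drop (size u) a).
Proof.
rewrite /wsum size_cat qsumD; congr (_ + _).
  by apply: eq_qsum => // k ku; rewrite qroot_catl.
rewrite /qsum mulmx_sumr; apply: eq_bigr => k _.
by rewrite /weight nth_drop qroot_catr scalemxAr.
Qed.

Lemma wskew_cat u v a b :
  wskew (u ++ v) a b = wskew u a b
    + wskew v (drop (size u) a) (drop (size u) b)
    + (qform C (wsum u a) (qprod C u *m wsum v (drop (size u) b))
       - qform C (qprod C u *m wsum v (drop (size u) a)) (wsum u b)) / 2.
Proof.
have ew c : qsum (size v) (fun k => weight c (size u + k))
    (fun k => qroot C (u ++ v) (size u + k))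
  = qprod C u *m wsum v (drop (size u) c).
  rewrite /wsum /qsum mulmx_sumr; apply: eq_bigr => k _.
  by rewrite /weight nth_drop qroot_catr scalemxAr.
have eu c : qsum (size u) (weight c) (qroot C (u ++ v)) = wsum u c.
  by apply: eq_qsum => // k ku; rewrite qroot_catl.
rewrite /wskew size_cat skew_sumD //= !ew !eu; congr (_ + _ + _).
  by apply: eq_skew_sum => // k ku; rewrite qroot_catl.
rewrite /skew_sum; congr (_ / _); apply: eq_bigr => k _; apply: eq_bigr => l _.
by rewrite /weight !nth_drop !qroot_catr qprod_iso.
Qed.

Lemma eq_wsum w a a' :
  (forall k, (k < size w)%N -> nth 0%N a k = nth 0%N a' k) -> wsum w a = wsum w a'.
Proof. by move=> e; apply: eq_qsum => // k kw; rewrite /weight e. Qed.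

Lemma eq_wskew w a a' b b' :
    (forall k, (k < size w)%N -> nth 0%N a k = nth 0%N a' k) ->
    (forall k, (k < size w)%N -> nth 0%N b k = nth 0%N b' k) ->
  wskew w a b = wskew w a' b'.
Proof.
by move=> ea eb; apply: eq_skew_sum => // k kw; rewrite /weight ?ea ?eb.
Qed.

Lemma wsum_four i k a : C i k = 0 ->
  wsum [:: i; k] a = weight a 0 *: qsimple i + weight a 1 *: qsimple k.
Proof.
move=> Cik; rewrite /wsum !qsumS /qsum big_ord0 add0r.
rewrite (qroot_rcons C [:: i] k) (qroot_rcons C [::] i : qroot C [:: i; k] 0 = _).
by rewrite qprod_cons qprod_nil mulmx1 mul1mx qrefl_simple Cik scale0r subr0.
Qed.

Lemma wskew_four i k a b : C i k = 0 -> wskew [:: i; k] a b = 0.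
Proof.
move=> Cik; rewrite /wskew !skew_sumS // skew_sum0 !qsumS /qsum !big_ord0.
rewrite (qroot_rcons C [:: i] k) (qroot_rcons C [::] i : qroot C [:: i; k] 0 = _).
rewrite qprod_cons qprod_nil mulmx1 mul1mx qrefl_simple Cik scale0r subr0.
rewrite !add0r !qform0l !qformZl qform_simple Cik.
by ring.
Qed.

Lemma qroot_six i j k : C i j = -1 -> (k < 3)%N ->
  qroot C [:: i; j; i] k
  = nth 0 [:: qsimple i; qsimple i + qsimple j; qsimple j] k.
Proof.
move=> Cij; have Cji : C j i = -1 by rewrite -Csym mxE.
case: k => [|[|[|]]] // _; rewrite /=.
- by rewrite (qroot_rcons C [::] i : qroot C [:: i; j; i] 0 = _) qprod_nil mul1mx.
- rewrite (qroot_rcons C [:: i] j : qroot C [:: i; j; i] 1 = _).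
  rewrite qprod_cons qprod_nil mulmx1 qrefl_simple Cij.
  by apply/matrixP => p q; rewrite !mxE; ring.
rewrite (qroot_rcons C [:: i; j] i) !qprod_cons qprod_nil mulmx1 -mulmxA.
rewrite qrefl_simple Cji mulmxBr -scalemxAr !qrefl_simple Cij Cdiag.
by apply/matrixP => p q; rewrite !mxE; ring.
Qed.

Lemma wsum_six i j a : C i j = -1 ->
  wsum [:: i; j; i] a = (weight a 0 + weight a 1) *: qsimple i
    + (weight a 1 + weight a 2) *: qsimple j.
Proof.
move=> Cij; rewrite /wsum !qsumS /qsum big_ord0 !qroot_six //=.
by apply/matrixP => p q; rewrite !mxE; ring.
Qed.

(** The roots are alpha_i, alpha_i + alpha_j, alpha_j. Neighbours pair to 1 and the outer two to -1,
    which are the signs of the 2 by 2 minors in the expansion of [det3] along its row of ones. *)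
Lemma wskew_six i j a b : C i j = -1 -> wskew [:: i; j; i] a b = det3 a b / 2.
Proof.
move=> Cij; have Cji : C j i = -1 by rewrite -Csym mxE.
rewrite /wskew !skew_sumS // skew_sum0 !qsumS /qsum !big_ord0 !qroot_six //= !add0r.
rewrite !(qformDl, qformDr, qformZl, qform0l) !qform_simple.
rewrite ?Cij ?Cji !Cdiag det3E.
by field.
Qed.

(** By [wsum_cat] and [wskew_cat], the strands outside see the middle factor only through its Weyl
    group element and its vector. If both are kept, the skew form changes only by the contribution
    internal to the middle. *)
Lemma replace_middle u l l' y a b la lb :
    let sub c c' := take (size u) c ++ c' ++ drop (size u + size l) c in
    (size u <= size a)%N -> (size u <= size b)%N ->
    size l' = size l -> size la = size l -> size lb = size l ->
    qprod C l' = qprod C l ->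
    wsum l' la = wsum l (drop (size u) a) ->
    wsum l' lb = wsum l (drop (size u) b) ->
  [/\ qprod C (u ++ l' ++ y) = qprod C (u ++ l ++ y),
      wsum (u ++ l' ++ y) (sub a la) = wsum (u ++ l ++ y) a
    & wskew (u ++ l' ++ y) (sub a la) (sub b lb)
      = wskew (u ++ l ++ y) a b
        + (wskew l' la lb - wskew l (drop (size u) a) (drop (size u) b))].
Proof.
move=> sub ua ub sl sla slb pl ela elb.
have sub_left c c' k : (size u <= size c)%N -> (k < size u)%N ->
    nth 0%N (sub c c') k = nth 0%N c k.
  by move=> uc ku; rewrite nth_cat size_takel // ku nth_take.
have sub_drop c c' : (size u <= size c)%N ->
    drop (size u) (sub c c') = c' ++ drop (size u + size l) c.
  by move=> uc; rewrite drop_size_cat // size_takel.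
have drop2 c c' : size c' = size l ->
    drop (size l') (c' ++ drop (size u + size l) c)
    = drop (size l) (drop (size u) c).
  by move=> sc; rewrite sl -sc drop_size_cat // drop_drop addnC sc.
have mid (c c' : seq nat) k : size c' = size l -> (k < size l')%N ->
    nth 0%N (c' ++ c) k = nth 0%N c' k.
  by move=> sc kl; rewrite nth_cat sc -sl kl.
have eu c c' : (size u <= size c)%N -> wsum u (sub c c') = wsum u c.
  by move=> uc; apply: eq_wsum => k ku; apply: sub_left.
have em c c' : size c' = size l -> wsum l' (c' ++ c) = wsum l' c'.
  by move=> sc; apply: eq_wsum => k kl; apply: mid.
split; first by rewrite !qprod_cat pl.
  by rewrite !wsum_cat pl sub_drop // drop2 // eu // em // ela.
rewrite !wskew_cat !wsum_cat !sub_drop // !drop2 // !eu // !em // pl ela elb.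
rewrite (@eq_wskew u (sub a la) a (sub b lb) b).
- rewrite (@eq_wskew l' (la ++ _) la (lb ++ _) lb); first ring.
    by move=> k kl; apply: mid.
  by move=> k kl; apply: mid.
- by move=> k ku; apply: sub_left.
by move=> k ku; apply: sub_left.
Qed.

(** The propagation rules are the change of coordinates that keeps the vector of a cycle fixed. The
    six-valent local intersection is the loss of the internal skew form (see [wskew_six]); at a
    four-valent vertex the two roots are orthogonal and nothing is lost. *)
Lemma slice_braid w v w' a b :
    slice C w v w' -> ~~ trivalent v -> size a = size w -> size b = size w ->
  [/\ qprod C w' = qprod C w, wsum w' (propagate v a) = wsum w a
    & local_intersection v a (propagate v a) b (propagate v b)
      + wskew w' (propagate v a) (propagate v b) = wskew w a b].
Proof.
case=> // [x y i k Cik|x y i j Cij] _; rewrite !size_cat => sa sb.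
- have Cki : C k i = 0 by rewrite -Csym mxE.
  have ew c : wsum [:: k; i] [:: nth 0%N c (size x).+1; nth 0%N c (size x)]
      = wsum [:: i; k] (drop (size x) c).
    by rewrite !wsum_four // /weight !nth_drop /= addn0 addn1 addrC.
  have := @replace_middle x [:: i; k] [:: k; i] y a b
    [:: nth 0%N a (size x).+1; nth 0%N a (size x)]
    [:: nth 0%N b (size x).+1; nth 0%N b (size x)].
  rewrite /= addn2; case=> //; try lia; first by rewrite qprod_four.
  by move=> -> -> ->; split=> //; rewrite !wskew_four // add0r subrr addr0.
have Cji : C j i = -1 by rewrite -Csym mxE.
pose out c := let e := nth 0%N c in
  let m := minn (e (size x)) (e (size x).+2) in
  [:: (e (size x).+1 + e (size x).+2 - m)%N; m;
      (e (size x) + e (size x).+1 - m)%N].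
(* With incoming weights e0, e1, e2 both sides have coefficient e1 + e2 on alpha_j and e0 + e1 on
   alpha_i. The truncated subtractions in [out] are exact, because m is at most e0 and e2. *)
have ew c : wsum [:: j; i; j] (out c) = wsum [:: i; j; i] (drop (size x) c).
  rewrite !wsum_six // /weight !nth_drop /= addn0 addn1 addn2 -!natrD addrC.
  by congr (_%:R *: _ + _%:R *: _); lia.
rewrite local_intersection_six.
have := @replace_middle x [:: i; j; i] [:: j; i; j] y a b (out a) (out b).
rewrite /= addn3; case=> //; try lia; first by rewrite qprod_six.
move=> -> -> e; split=> //; rewrite {}e !wskew_six //.
rewrite !drop_size_cat ?size_takel; try lia.
have -> p q : det3 (out a ++ p) (out b ++ q) = det3 (out a) (out b).
  by rewrite !det3E.
by field.
Qed.

Lemma weave_braid w mu w' a b :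
    weave C w mu w' -> ~~ has trivalent mu -> size a = size w -> size b = size w ->
  [/\ qprod C w' = qprod C w, wsum w' (flow mu a) = wsum w a
    & flow_intersection mu a b + wskew w' (flow mu a) (flow mu b)
      = wskew w a b].
Proof.
move=> wv; elim: wv a b => /= [w0|w0 v w1 om h sl _ IH] a b.
  by rewrite add0r.
rewrite negb_or => /andP[nv nom] sa sb.
have [e1 e2 e3] := slice_braid sl nv sa sb.
have [||f1 f2 f3] := IH (propagate v a) (propagate v b) nom.
- exact: size_propagate sl sa.
- exact: size_propagate sl sb.
by rewrite -addrA f3 e3 f1 f2 e1 e2.
Qed.

End Braid.

(** * Roots at the solid positions *)

Section SolidRoots.

Variables (n : nat) (C : 'M[int]_n).
Hypotheses (Cdiag : forall i, C i i = 2) (Csym : C^T = C).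

Implicit Types (b : seq 'I_n) (i : 'I_n).

Definition qdemazure b : 'M[rat]_n := map_mx intr (demazure C b).

(* The root of the strand entering from the left the trivalent vertex created
   at the solid position [q]. *)
Definition merge_root b (q : nat) : 'cV[rat]_n :=
  - (qdemazure (take q b) *m nth 0 [seq qsimple i | i <- b] q).

Definition solid_merge_root b (j : nat) : 'cV[rat]_n :=
  merge_root b (nth 0%N (solids C b) j).

Definition solid_word_root b (j : nat) : 'cV[rat]_n :=
  qroot C b (nth 0%N (solids C b) j).

(** [bruhat_max] returns one of its two arguments, and [solid] tests whether the result equals the
    old element. *)
Lemma qdemazure_rcons b i :
  qdemazure (rcons b i) = if solid C (rcons b i) (size b) then qdemazure b
                          else qdemazure b *m qrefl C i.
Proof.
rewrite /qdemazure.
have -> : solid C (rcons b i) (size b)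
    = (demazure C (rcons b i) == demazure C b).
  by rewrite /solid -(size_rcons b i) take_size -cats1 take_size_cat.
have -> : demazure C (rcons b i)
    = bruhat_max C (demazure C b) (demazure C b *m refl C i).
  by rewrite {1}/demazure foldl_rcons.
rewrite /bruhat_max; case: asbool; last by rewrite eqxx.
by case: eqP => [->//|_]; rewrite map_mxM.
Qed.

Lemma qdemazure_iso b x y :
  qform C (qdemazure b *m x) (qdemazure b *m y) = qform C x y.
Proof.
elim/last_ind: b x y => [|b i IH] x y.
  by rewrite /qdemazure /= map_mx1 !mul1mx.
by rewrite qdemazure_rcons; case: ifP; rewrite // -!mulmxA IH qrefl_iso.
Qed.

Lemma solids_rcons b i :
  solids C (rcons b i) = if solid C (rcons b i) (size b)
                         then rcons (solids C b) (size b) else solids C b.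
Proof.
rewrite /solids size_rcons -addn1 iotaD filter_cat /= add0n.
set s := [seq _ <- _ | _]; suff -> : s = solids C b.
  by case: ifP; rewrite ?cats1 ?cats0.
apply: eq_in_filter => k; rewrite mem_iota add0n /= => kb.
by rewrite /solid -!cats1 !takel_cat // ltnW.
Qed.

Lemma solid_lt b j : (j < size (solids C b))%N ->
  (nth 0%N (solids C b) j < size b)%N.
Proof.
by move=> /(mem_nth 0%N); rewrite mem_filter mem_iota => /andP[].
Qed.

Lemma nth_solids_rcons b i j : (j < size (solids C b))%N ->
  nth 0%N (solids C (rcons b i)) j = nth 0%N (solids C b) j.
Proof. by move=> jb; rewrite solids_rcons; case: ifP; rewrite // nth_rcons jb. Qed.

Lemma solid_merge_root_rcons b i j : (j < size (solids C b))%N ->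
  solid_merge_root (rcons b i) j = solid_merge_root b j.
Proof.
move=> jb; rewrite /solid_merge_root nth_solids_rcons //.
have := solid_lt jb; set q := nth _ _ _ => qb.
by rewrite /merge_root -cats1 takel_cat 1?ltnW // map_cat nth_cat size_map qb.
Qed.

Lemma solid_word_root_rcons b i j : (j < size (solids C b))%N ->
  solid_word_root (rcons b i) j = solid_word_root b j.
Proof.
move=> jb; rewrite /solid_word_root nth_solids_rcons //.
by rewrite -cats1 qroot_catl // solid_lt.
Qed.

Lemma solid_merge_root_last b i : solid C (rcons b i) (size b) ->
  solid_merge_root (rcons b i) (size (solids C b)) = - (qdemazure b *m qsimple i).
Proof.
move=> sol; rewrite /solid_merge_root solids_rcons sol nth_rcons ltnn eqxx.
rewrite /merge_root -cats1 take_size_cat //.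
by rewrite map_cat nth_cat size_map ltnn subnn.
Qed.

Lemma solid_word_root_last b i : solid C (rcons b i) (size b) ->
  solid_word_root (rcons b i) (size (solids C b)) = qprod C b *m qsimple i.
Proof.
move=> sol; rewrite /solid_word_root solids_rcons sol nth_rcons ltnn eqxx.
exact: qroot_rcons.
Qed.

Lemma qform_solid_merge_root b j : (j < size (solids C b))%N ->
  qform C (solid_merge_root b j) (solid_merge_root b j) = 2.
Proof.
elim/last_ind: b => // b i IH; rewrite solids_rcons.
case: (boolP (solid _ _ _)) => sol jb; last by rewrite solid_merge_root_rcons ?IH.
move: jb; rewrite size_rcons ltnS leq_eqVlt => /predU1P[->|jb]; last first.
  by rewrite solid_merge_root_rcons ?IH.
rewrite solid_merge_root_last // qformNl qformNr opprK qdemazure_iso.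
by rewrite qform_simple Cdiag.
Qed.

(* Each solid letter [i] multiplies the word by [s_i] and leaves the Demazure
   product [d] unchanged, so that [prod b = t_1 ... t_N * d] with [t_j] the
   reflection in the j-th merge root; this expands the product of reflections. *)
Lemma qprod_qdemazure b (x : 'cV_n) :
  qprod C b *m x = qdemazure b *m x
    + \sum_(j < size (solids C b))
        qform C (solid_merge_root b j) (qdemazure b *m x) *: solid_word_root b j.
Proof.
elim/last_ind: b x => [|b i IH] x.
  by rewrite /qdemazure qprod_nil /= map_mx1 big_ord0 addr0.
rewrite qprod_rcons -mulmxA IH qdemazure_rcons solids_rcons.
case: (boolP (solid _ _ _)) => sol; last first.
  rewrite !mulmxA; congr (_ + _); apply: eq_bigr => j _.
  by rewrite solid_merge_root_rcons ?solid_word_root_rcons.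
rewrite size_rcons big_ord_recr /= solid_merge_root_last ?solid_word_root_last //.
under [in RHS]eq_bigr => j _ do
  rewrite solid_merge_root_rcons ?solid_word_root_rcons //.
(* Folding both expansions back, the claim is that [qprod C b] applied to s_i x and to x differ by
   -(alpha_i, x) times the new word root. The coefficient is right because the new merge root is
   -d(alpha_i) and d is an isometry. *)
rewrite addrA -!IH qrefl_act mulmxBr -scalemxAr qformNl qdemazure_iso.
by rewrite scaleNr.
Qed.

(** For the last solid letter i, apply [qprod_qdemazure] to alpha_i: the left side is the new word
    root, and d(alpha_i) on the right is minus the new merge root. Earlier positions are unaffected
    by later letters. In matrix form this is R = - alpha V. *)
Lemma solid_merge_root_expand b j : (j < size (solids C b))%N ->
  solid_merge_root b j = - (solid_word_root b j
    + \sum_(i < j) qform C (solid_merge_root b i) (solid_merge_root b j)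
        *: solid_word_root b i).
Proof.
elim/last_ind: b j => // b i IH j; rewrite solids_rcons.
have old k : (k < size (solids C b))%N ->
  solid_merge_root (rcons b i) k = - (solid_word_root (rcons b i) k
    + \sum_(l < k) qform C (solid_merge_root (rcons b i) l)
        (solid_merge_root (rcons b i) k) *: solid_word_root (rcons b i) l).
  move=> kb; rewrite solid_merge_root_rcons // solid_word_root_rcons // {1}IH //.
  congr (- (_ + _)); apply: eq_bigr => l _; have lb := ltn_trans (ltn_ord l) kb.
  by rewrite solid_merge_root_rcons ?solid_word_root_rcons.
case: (boolP (solid _ _ _)) => sol jb; last exact: old.
move: jb; rewrite size_rcons ltnS leq_eqVlt => /predU1P[->|]; last exact: old.
rewrite solid_merge_root_last // solid_word_root_last // qprod_qdemazure.
rewrite -addrA -big_split /= big1 ?addr0 // => k _.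
rewrite solid_merge_root_rcons ?solid_word_root_rcons // -scalerDl qformNr.
by rewrite subrr scale0r.
Qed.

End SolidRoots.

(** * Lusztig cycles of a weave *)

(** Weights are read with default 0, so a strand of weight 0 on the right is invisible. Cycles of
    [b] and of [rcons b i] are compared through this. *)
Lemma nth_rcons0 (a : seq nat) k : nth 0%N (rcons a 0%N) k = nth 0%N a k.
Proof.
by rewrite nth_rcons; case: ltngtP => // ak; rewrite nth_default // ?ak // ltnW.
Qed.

Lemma eq_local_intersection v a1 a1' b1 b1' a2 a2' b2 b2' :
    nth 0%N a1 =1 nth 0%N a2 -> nth 0%N a1' =1 nth 0%N a2' ->
    nth 0%N b1 =1 nth 0%N b2 -> nth 0%N b1' =1 nth 0%N b2' ->
  local_intersection v a1 a1' b1 b1' = local_intersection v a2 a2' b2 b2'.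
Proof.
by move=> ea ea' eb eb'; case: v => p //=; rewrite !det3E /weight /=
  !ea !ea' !eb !eb'.
Qed.

Lemma propagate_rcons n (C : 'M[int]_n) w v w' a c :
    slice C w v w' -> size a = size w ->
  propagate v (rcons a c) = rcons (propagate v a) c.
Proof.
have drop_le q : (q <= size a)%N -> drop q (a ++ [:: c]) = drop q a ++ [:: c].
  rewrite drop_cat; case: ltngtP => // -> _.
  by rewrite subnn drop0 drop_size.
case=> [x y i|x y i k _|x y i j _]; rewrite !size_cat /= => sa;
  rewrite !nth_rcons !ifT; try lia;
  by rewrite -!cats1 takel_cat ?drop_le -?catA; try lia.
Qed.

Lemma flow_rcons n (C : 'M[int]_n) w om w' a c :
    weave C w om w' -> size a = size w -> flow om (rcons a c) = rcons (flow om a) c.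
Proof.
move=> wv; elim: wv a => //= w0 v w1 om0 h sl _ IH a sa.
by rewrite (propagate_rcons _ sl) // IH // (size_propagate sl).
Qed.

Lemma flow_intersection_rcons0 n (C : 'M[int]_n) w om w' a b :
    weave C w om w' -> size a = size w -> size b = size w ->
  flow_intersection om (rcons a 0%N) (rcons b 0%N) = flow_intersection om a b.
Proof.
move=> wv; elim: wv a b => //= w0 v w1 om0 h sl _ IH a b sa sb.
rewrite !(propagate_rcons _ sl) // IH ?(size_propagate sl) //; congr (_ + _).
by apply: eq_local_intersection => k; rewrite nth_rcons0.
Qed.

Lemma weave_rconsP n (C : 'M[int]_n) b om v h :
  weave C b (rcons om v) h -> exists2 w, weave C b om w & slice C w v h.
Proof.
move E: (rcons om v) => om' wv; elim: wv om E => [b0|b0 v0 b1 om0 h0 sl wv IH] om.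
  by case: om.
case: om => [|v1 om] /= [ev eom].
  rewrite -eom in wv; exists b0; first exact: WeaveNil.
  by inversion wv; subst.
have [w w1 w2] := IH om eom.
by exists w => //; rewrite ev; apply: WeaveCons sl w1.
Qed.

Lemma lusztig_cat r om om' k t :
  (t <= size om)%N -> lusztig r (om ++ om') k t = lusztig r om k t.
Proof.
by elim: t => //= t IH ts; rewrite IH ?(ltnW ts) // nth_cat ts.
Qed.

(** Once the vertex that creates the cycle has been passed, only propagation remains. *)
Lemma lusztig_flow r om om' k : (k < size om)%N ->
  lusztig r (om ++ om') k (size om + size om')
  = flow om' (lusztig r om k (size om)).
Proof.
move=> kom; elim/last_ind: om' => [|om' v IH].
  by rewrite cats0 addn0.
rewrite size_rcons addnS /= -cats1 catA lusztig_cat ?size_cat // IH.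
rewrite nth_cat size_cat ltnn subnn /= gtn_eqF ?ltn_addr //.
by rewrite /flow foldl_cat.
Qed.

Lemma nth_all0 a k : all (pred1 0%N) a -> nth 0%N a k = 0%N.
Proof.
move=> a0; have [ka|ka] := ltnP k (size a); last by rewrite nth_default.
by apply/eqP/(all_nthP 0%N a0).
Qed.

Lemma all0_propagate v a : all (pred1 0%N) a -> all (pred1 0%N) (propagate v a).
Proof.
move=> a0; have n0 k := nth_all0 k a0.
have sub p l : all (pred1 0%N) l ->
    forall q, all (pred1 0%N) (take p a ++ l ++ drop q a).
  move=> l0 q; rewrite !all_cat l0 /=; apply/andP; split; apply/allP => z.
    by move/mem_take/(allP a0).
  by move/mem_drop/(allP a0).
by case: v => p /=; rewrite !n0; apply: (sub _ [:: _]) || apply: (sub _ [:: _; _])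
  || apply: (sub _ [:: _; _; _]).
Qed.

Lemma all0_lusztig r om k t :
  (t <= k)%N -> all (pred1 0%N) (lusztig r om k t).
Proof.
elim: t => [_|t IH tk] /=; first by rewrite all_nseq orbT.
by rewrite ltn_eqF // all0_propagate // IH // ltnW.
Qed.

Lemma vpos_slice n (C : 'M[int]_n) w v w' : slice C w v w' -> (vpos v < size w')%N.
Proof. by case=> *; rewrite !size_cat /=; lia. Qed.

(** A further letter of the top word is a strand that no vertex of [om] touches, hence of weight 0
    throughout. The size claim goes into the same induction because [propagate_rcons] needs the
    length of the list on each line. *)
Lemma lusztig_weave n (C : 'M[int]_n) b om h k : weave C b om h ->
  size (lusztig (size b) om k (size om)) = size h /\
  forall t, (t <= size om)%N ->
    lusztig (size b).+1 om k t = rcons (lusztig (size b) om k t) 0%N.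
Proof.
elim/last_ind: om h => [|om v IH] h wv.
  have -> : b = h by inversion wv.
  split; first by rewrite size_nseq.
  by case=> // _ /=; elim: (size h) => //= r <-.
have [w wom sl] := weave_rconsP wv; have [sw e] := IH w wom.
have {}e t : (t <= size om)%N -> lusztig (size b).+1 (rcons om v) k t
    = rcons (lusztig (size b) (rcons om v) k t) 0%N.
  by move=> tom; rewrite -cats1 !lusztig_cat ?e.
have sw' : size (lusztig (size b) (rcons om v) k (size om)) = size w.
  by rewrite -cats1 lusztig_cat ?sw.
have sp := size_propagate sl sw'; have vp := vpos_slice sl.
split.
  rewrite size_rcons /= nth_rcons ltnn eqxx.
  (* Writing the initial weight 1 does not lengthen the list, since [vpos v] is a position on the
     line below [v]. *)
  by case: ifP => // _; rewrite size_set_nth sp; apply/maxn_idPr.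
move=> t; rewrite size_rcons leq_eqVlt => /predU1P[->|]; last exact: e.
rewrite /= e // nth_rcons ltnn eqxx (propagate_rcons _ sl) //.
case: ifP => // _; apply: (@eq_from_nth _ 0%N) => [|j _].
  by rewrite size_rcons !size_set_nth size_rcons sp; lia.
by rewrite nth_rcons0 !nth_set_nth /= nth_rcons0.
Qed.

Definition cycle_intersection (r : nat) (om : seq vertex) (k l : nat) : rat :=
  \sum_(t < size om) local_intersection (nth (Tri 0) om t)
    (lusztig r om k t) (lusztig r om k t.+1)
    (lusztig r om l t) (lusztig r om l t.+1).

Lemma flow_intersection_rcons om v a b :
  flow_intersection (rcons om v) a b = flow_intersection om a b
    + local_intersection v (flow om a) (propagate v (flow om a))
        (flow om b) (propagate v (flow om b)).
Proof.
elim: om a b => [|u om IH] a b /=; first by rewrite addr0 add0r.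
by rewrite IH addrA.
Qed.

Lemma cycle_intersection_rcons r om v k l :
  cycle_intersection r (rcons om v) k l = cycle_intersection r om k l
    + local_intersection v
        (lusztig r om k (size om)) (lusztig r (rcons om v) k (size om).+1)
        (lusztig r om l (size om)) (lusztig r (rcons om v) l (size om).+1).
Proof.
rewrite /cycle_intersection size_rcons big_ord_recr [nth _ _ (nat_of_ord ord_max)]/=.
rewrite nth_rcons ltnn eqxx -cats1 !(lusztig_cat _ _ _ (leqnn _)); congr (_ + _).
apply: eq_bigr => t _; have tom := ltn_ord t.
by rewrite nth_cat tom !lusztig_cat // ltnW.
Qed.

Lemma cycle_intersection_cat r om om' k l :
    (k < size om)%N -> (l < size om)%N ->
  cycle_intersection r (om ++ om') k l = cycle_intersection r om k l
    + flow_intersection om' (lusztig r om k (size om)) (lusztig r om l (size om)).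
Proof.
move=> kom lom; elim/last_ind: om' => [|om' v IH]; first by rewrite cats0 addr0.
rewrite -rcons_cat cycle_intersection_rcons IH flow_intersection_rcons -addrA.
rewrite rcons_cat size_cat -addnS -(size_rcons om' v) !lusztig_flow //.
by rewrite /flow !foldl_rcons.
Qed.

Lemma cycle_intersection_anti r om k l :
  cycle_intersection r om k l = - cycle_intersection r om l k.
Proof.
by rewrite -sumrN; apply: eq_bigr => t _; apply: local_intersection_anti.
Qed.

Lemma trivalents_merge om mu p : ~~ has trivalent mu ->
  trivalents (om ++ rcons mu (Tri p)) = rcons (trivalents om) (size om + size mu).
Proof.
move=> nmu; rewrite /trivalents size_cat size_rcons addnS -addn1 -addnA.
rewrite !iotaD !filter_cat add0n /= -[RHS]cats1; congr (_ ++ _).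
  apply: eq_in_filter => t; rewrite mem_iota /= add0n => tom.
  by rewrite nth_cat tom.
rewrite -[RHS]cat0s; congr (_ ++ _); last first.
  by rewrite nth_cat ltnNge leq_addr addKn nth_rcons ltnn eqxx.
rewrite (@eq_in_filter _ _ pred0) ?filter_pred0 // => t.
rewrite mem_iota => /andP[t1 t2].
have tmu : (t - size om < size mu)%N by lia.
rewrite nth_cat ltnNge t1 /= nth_rcons tmu.
apply/negbTE; apply: contra nmu => tv.
by apply/(has_nthP (Tri 0)); exists (t - size om)%N.
Qed.

Lemma trivalents_lt om i : (i < size (trivalents om))%N ->
  (nth 0%N (trivalents om) i < size om)%N.
Proof.
by move=> /(mem_nth 0%N); rewrite mem_filter mem_iota => /andP[].
Qed.

(** * Right inductive weaves *)

Definition tri_index (om : seq vertex) (i : nat) : nat := nth 0%N (trivalents om) i.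

(* The entries of I - A. *)
Definition one_sub_A (r : nat) (om : seq vertex) (i j : nat) : rat :=
  (i == j)%:R -
  if (i < j)%N then
    weight (lusztig r om (tri_index om i) (tri_index om j))
      (vpos (nth (Tri 0) om (tri_index om j)))
  else 0.

(** The freshly inserted strand has weight 0, so the minimum is 0 and the weight x of the left
    strand is lost. These lost weights are the entries of [A]. *)
Lemma propagate_merge p a x :
  size a = p -> propagate (Tri p) (rcons (rcons a x) 0%N) = rcons a 0%N.
Proof.
move=> <-; rewrite /= drop_oversize ?size_rcons // !nth_rcons !size_rcons ltnn.
by rewrite eqxx ltnSn ltnn eqxx minn0 -!cats1 -catA take_size_cat.
Qed.

Lemma lusztig_below r om v k : (k < size om)%N ->
  lusztig r (rcons om v) k (size om).+1
  = propagate v (lusztig r (rcons om v) k (size om)).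
Proof. by move=> kom; rewrite /= gtn_eqF // nth_rcons ltnn eqxx. Qed.

Lemma lusztig_new r om v :
  lusztig r (rcons om v) (size om) (size om).+1
  = set_nth 0%N (propagate v (lusztig r (rcons om v) (size om) (size om)))
      (vpos v) 1%N.
Proof. by rewrite /= eqxx nth_rcons ltnn eqxx. Qed.

Lemma local_intersection_eq0 v a a' b b' :
  all (pred1 0%N) b -> all (pred1 0%N) b' -> local_intersection v a a' b b' = 0.
Proof.
move=> b0 b0'; case: v => p //=; rewrite !det3E /weight /=;
  by rewrite !(nth_all0 _ b0, nth_all0 _ b0'); ring.
Qed.

Section RightInductive.

Variables (n : nat) (C : 'M[int]_n).
Hypotheses (Cdiag : forall i, C i i = 2) (Csym : C^T = C).

Lemma wsum_rcons w i a x : size a = size w ->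
  wsum C (rcons w i) (rcons a x)
  = wsum C w a + x%:R *: (qprod C w *m qsimple i).
Proof.
move=> sa; rewrite /wsum size_rcons qsumS qroot_rcons /weight nth_rcons sa ltnn eqxx.
by congr (_ + _); apply: eq_qsum => k kw;
  rewrite ?nth_rcons ?sa ?kw // -cats1 qroot_catl.
Qed.

Lemma wskew_rcons w i a x b y : size a = size w -> size b = size w ->
  wskew C (rcons w i) (rcons a x) (rcons b y)
  = wskew C w a b
    + (y%:R * qform C (wsum C w a) (qprod C w *m qsimple i)
       - x%:R * qform C (wsum C w b) (qprod C w *m qsimple i)) / 2.
Proof.
move=> sa sb; rewrite /wskew size_rcons skew_sumS // qroot_rcons /weight.
have eS c z : size c = size w ->
    qsum (size w) (fun k => (nth 0%N (rcons c z) k)%:R) (qroot C (rcons w i))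
    = wsum C w c.
  move=> sc; apply: eq_qsum => k kw; first by rewrite nth_rcons sc kw.
  by rewrite -cats1 qroot_catl.
rewrite !eS // !nth_rcons sa sb ltnn eqxx; congr (_ + _).
by apply: eq_skew_sum => k kw; rewrite ?nth_rcons ?sa ?sb ?kw // -cats1 qroot_catl.
Qed.

Lemma qsum_eq0 m (x : nat -> rat) (r : nat -> 'cV[rat]_n) :
  (forall k, (k < m)%N -> x k = 0) -> qsum m x r = 0.
Proof. by move=> x0; apply: big1 => k _; rewrite x0 // scale0r. Qed.

Lemma skew_sum_eq0 m (x y : nat -> rat) (r : nat -> 'cV[rat]_n) :
  (forall k, (k < m)%N -> y k = 0) -> skew_sum C m x y r = 0.
Proof.
move=> y0; rewrite /skew_sum big1 ?mul0r // => k _; rewrite big1 // => l _.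
by rewrite y0 // mulr0 mul0r.
Qed.

Lemma wskew_rcons0 w i a b : size a = size w -> size b = size w ->
  wskew C (rcons w i) (rcons a 0%N) (rcons b 0%N) = wskew C w a b.
Proof. by move=> sa sb; rewrite wskew_rcons //; ring. Qed.

Let N (b : seq 'I_n) := size (solids C b).

(** One induction along the construction carries all four claims. A strand that is merely adjoined
    has weight 0 and changes nothing; a merge appends to each old row of [I - A] the negative of the
    weight it kills, and adds a new unit row. The last two claims then follow the recursions [qsumS]
    and [skew_sumS]. *)
Lemma right_inductive_cycles b om h : right_inductive C b om h ->
  let c i := lusztig (size b) om (tri_index om i) (size om) in
  let M := one_sub_A (size b) om in
  [/\ qprod C h = qdemazure C b,
      size (trivalents om) = N b,
      forall i, (i < N b)%N -> wsum C h (c i) = qsum (N b) (M i) (solid_merge_root C b)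
    & forall i j, (i < j < N b)%N ->
        cycle_intersection (size b) om (tri_index om i) (tri_index om j)
          + wskew C h (c i) (c j)
        = skew_sum C (N b) (M i) (M j) (solid_merge_root C b)].
Proof.
elim=> [|b0 om0 h0 i0 ri [IH1 IH2 IH3 IH4] nsol
        |b0 om0 h0 i0 mu h1 ri [IH1 IH2 IH3 IH4] sol wmu nmu] /=.
- by split=> // i j /andP[].
- have wv := right_inductive_weave ri.
  have eN : N (rcons b0 i0) = N b0 by rewrite /N solids_rcons (negbTE nsol).
  rewrite eN size_rcons.
  have lus k t : (t <= size om0)%N -> lusztig (size b0).+1 om0 k t
      = rcons (lusztig (size b0) om0 k t) 0%N by apply: (lusztig_weave k wv).2.
  have slus k := (lusztig_weave k wv).1.
  have tri j : (j < N b0)%N -> (tri_index om0 j < size om0)%N.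
    by rewrite -IH2; apply: trivalents_lt.
  have eM i j : (j < N b0)%N ->
      one_sub_A (size b0).+1 om0 i j = one_sub_A (size b0) om0 i j.
    by move=> /tri/ltnW tj; rewrite /one_sub_A lus // /weight nth_rcons0.
  have eR k : (k < N b0)%N ->
      solid_merge_root C (rcons b0 i0) k = solid_merge_root C b0 k.
    exact: solid_merge_root_rcons.
  split.
  + by rewrite qprod_rcons IH1 qdemazure_rcons (negbTE nsol).
  + exact: IH2.
  + move=> i iN; rewrite lus // wsum_rcons ?slus // scale0r addr0 IH3 //.
    by apply: eq_qsum => k kN; rewrite ?eM ?eR.
  move=> i j ijN; rewrite !lus // wskew_rcons0 ?slus //.
  rewrite (_ : skew_sum _ _ _ _ _ = skew_sum C (N b0) (one_sub_A (size b0) om0 i)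
    (one_sub_A (size b0) om0 j) (solid_merge_root C b0)); last first.
    by apply: eq_skew_sum => k kN; rewrite ?eM ?eR.
  rewrite -IH4 //; congr (_ + _); apply: eq_bigr => t _.
  by apply: eq_local_intersection => k; rewrite lus ?nth_rcons0 // ltnW.
(* The solid case. Below, [om1] is the weave just before the merge, [K] the index of the new
   trivalent vertex and [p] its position. *)
have wv := right_inductive_weave ri.
have slus k := (lusztig_weave k wv).1.
have tri j : (j < N b0)%N -> (tri_index om0 j < size om0)%N.
  by rewrite -IH2; apply: trivalents_lt.
have eN : N (rcons b0 i0) = (N b0).+1.
  by rewrite /N solids_rcons sol size_rcons.
pose om1 := om0 ++ mu; pose K := size om1; pose p := size h1.
have eom : om0 ++ rcons mu (Tri p) = rcons om1 (Tri p) by rewrite rcons_cat.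
have szom : size (rcons om1 (Tri p)) = K.+1 by rewrite size_rcons.
have etri j : (j < N b0)%N -> tri_index (rcons om1 (Tri p)) j = tri_index om0 j.
  move=> jN; rewrite /tri_index -eom trivalents_merge // nth_rcons.
  by rewrite IH2 jN.
have etriN : tri_index (rcons om1 (Tri p)) (N b0) = K.
  rewrite /tri_index -eom trivalents_merge // nth_rcons IH2 ltnn eqxx.
  by rewrite /K /om1 size_cat.
have lus k t : (t <= size om0)%N ->
    lusztig (size b0).+1 (rcons om1 (Tri p)) k t
    = rcons (lusztig (size b0) om0 k t) 0%N.
  by move=> tom; rewrite -eom lusztig_cat //; apply: (lusztig_weave k wv).2.
pose rho := qprod C h1 *m qsimple i0.
have szK : K = (size om0 + size mu)%N by rewrite /K size_cat.
(* An old cycle reaches the merge with weights (a, x, 0) and leaves it with (a, 0). *)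
have cyc i : (i < N b0)%N -> exists a x,
    [/\ size a = p,
        flow mu (lusztig (size b0) om0 (tri_index om0 i) (size om0)) = rcons a x,
        lusztig (size b0).+1 (rcons om1 (Tri p)) (tri_index om0 i) K
        = rcons (rcons a x) 0%N
      & lusztig (size b0).+1 (rcons om1 (Tri p)) (tri_index om0 i) K.+1
        = rcons a 0%N].
  move=> iN; set k := tri_index om0 i.
  have := size_flow wmu (slus k); rewrite size_rcons.
  case/lastP E: (flow mu _) => [//|a x]; rewrite size_rcons => -[sa].
  have {}sa : size a = p by [].
  have eK : lusztig (size b0).+1 (rcons om1 (Tri p)) k K = rcons (rcons a x) 0%N.
    rewrite -cats1 lusztig_cat // szK lusztig_flow ?tri //.
    by rewrite (lusztig_weave k wv).2 // (flow_rcons _ wmu) // E.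
  exists a, x; split=> //; rewrite lusztig_below ?eK ?propagate_merge //.
  by rewrite -/K szK ltn_addr // tri.
have om1K k : lusztig (size b0).+1 om1 k K
    = lusztig (size b0).+1 (rcons om1 (Tri p)) k K.
  by rewrite -cats1 lusztig_cat.
pose zero := lusztig (size b0).+1 (rcons om1 (Tri p)) K K.
pose new := lusztig (size b0).+1 (rcons om1 (Tri p)) K K.+1.
have zero0 : all (pred1 0%N) zero by apply: all0_lusztig.
have new1 k : nth 0%N new k = nth 0%N (rcons (nseq p 0%N) 1%N) k.
  rewrite /new lusztig_new -/K -/zero.
  move: (propagate _ _) (all0_propagate (Tri p) zero0) => Z Z0.
  rewrite nth_set_nth /= nth_rcons size_nseq nth_nseq if_same.
  case: eqP => [->|_]; first by rewrite ltnn.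
  by rewrite if_same nth_all0.
(* The word [rcons h1 i0] represents the Demazure product d, so d(alpha_i) is the image under [h1]
   of s_i(alpha_i) = -alpha_i. This explains the sign in [merge_root]. *)
have rhoE : solid_merge_root C (rcons b0 i0) (N b0) = rho.
  rewrite solid_merge_root_last // -IH1.
  (* Only the equality of Weyl group elements is extracted; index 0 merely supplies lists of the
     right length. *)
  have [<- _ _] := weave_braid Cdiag Csym wmu nmu (slus 0) (slus 0).
  rewrite qprod_rcons -mulmxA qrefl_simple Cdiag /rho mulmxBr -scalemxAr.
  by apply/matrixP => k l; rewrite !mxE; ring.
have rho2 : qform C rho rho = 2.
  by rewrite -rhoE qform_solid_merge_root // -/(N _) eN.
have eM i j : (i < N b0)%N -> (j < N b0)%N ->
    one_sub_A (size b0).+1 (rcons om1 (Tri p)) i j = one_sub_A (size b0) om0 i j.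
  move=> iN jN; rewrite /one_sub_A !etri // lus; last exact/ltnW/tri.
  rewrite /weight nth_rcons0 -eom nth_cat tri //.
have eMN i a x : (i < N b0)%N -> size a = p ->
    lusztig (size b0).+1 (rcons om1 (Tri p)) (tri_index om0 i) K
    = rcons (rcons a x) 0%N ->
    one_sub_A (size b0).+1 (rcons om1 (Tri p)) i (N b0) = - x%:R.
  move=> iN sa e; rewrite /one_sub_A iN ltn_eqF // etriN etri // e.
  by rewrite nth_rcons ltnn eqxx /weight /= nth_rcons0 nth_rcons sa ltnn eqxx sub0r.
have eMNN k : (k <= N b0)%N ->
    one_sub_A (size b0).+1 (rcons om1 (Tri p)) (N b0) k = (N b0 == k)%:R.
  by move=> kN; rewrite /one_sub_A ltnNge kN subr0.
have eR k : (k < N b0)%N ->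
    solid_merge_root C (rcons b0 i0) k = solid_merge_root C b0 k.
  exact: solid_merge_root_rcons.
(* The old part of row i still gives the vector before the merge. The new coordinate -x from [eMN]
   will cancel x rho. *)
have eQ i a x : (i < N b0)%N -> size a = p ->
    flow mu (lusztig (size b0) om0 (tri_index om0 i) (size om0)) = rcons a x ->
  qsum (N b0) (one_sub_A (size b0).+1 (rcons om1 (Tri p)) i)
    (solid_merge_root C (rcons b0 i0)) = wsum C h1 a + x%:R *: rho.
  move=> iN sa e.
  rewrite -wsum_rcons // -e.
  have [_ -> _] := weave_braid Cdiag Csym wmu nmu (slus (tri_index om0 i)) (slus 0).
  by rewrite IH3 //; apply: eq_qsum => k kN; rewrite ?eM ?eR.
have eQN : qsum (N b0) (one_sub_A (size b0).+1 (rcons om1 (Tri p)) (N b0))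
    (solid_merge_root C (rcons b0 i0)) = 0.
  by apply: qsum_eq0 => k kN; rewrite eMNN 1?ltnW // gtn_eqF.
have enew : wsum C (rcons h1 i0) new = rho.
  rewrite (eq_wsum C (a' := rcons (nseq p 0%N) 1%N)); last by move=> k _.
  rewrite wsum_rcons ?size_nseq // scale1r /wsum qsum_eq0 ?add0r //.
  by move=> k _; rewrite /weight nth_nseq if_same.
rewrite size_rcons -/p eom eN szom; split.
- have [e _ _] := weave_braid Cdiag Csym wmu nmu (slus 0) (slus 0).
  by rewrite e IH1 qdemazure_rcons sol.
- by rewrite -eom trivalents_merge // size_rcons IH2.
- move=> i; rewrite ltnS leq_eqVlt => /predU1P[->|iN]; rewrite qsumS rhoE.
    by rewrite etriN -/new enew eQN add0r eMNN // eqxx scale1r.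
  have [a [x [sa ef eK eK1]]] := cyc i iN.
  rewrite etri // eK1 wsum_rcons // scale0r addr0 (eQ _ _ _ iN sa ef).
  by rewrite (eMN _ _ _ iN sa eK) scaleNr addrK.
move=> i j /andP[ij]; have iN : (j < N b0)%N -> (i < N b0)%N by apply: ltn_trans.
rewrite ltnS leq_eqVlt => /predU1P[ej|jN]; rewrite skew_sumS // rhoE.
  rewrite {}ej in ij *; have [a [x [sa ef eK eK1]]] := cyc i ij.
  rewrite etriN etri // eK1 -/new cycle_intersection_rcons -/K.
  rewrite !om1K eK eK1 -/zero -/new.
  rewrite (eMN _ _ _ ij sa eK) (eQ _ _ _ ij sa ef) eQN eMNN // eqxx qform0l.
  rewrite [X in _ = X + _]skew_sum_eq0; last first.
    by move=> k kN; rewrite eMNN 1?ltnW // gtn_eqF.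
  (* The new cycle vanishes above its own vertex. *)
  have -> : cycle_intersection (size b0).+1 om1 (tri_index om0 i) K = 0.
    apply: big1 => t _; rewrite local_intersection_eq0 //;
      apply: all0_lusztig => //.
    exact: ltnW.
  have -> : wskew C (rcons h1 i0) (rcons a 0%N) new = qform C (wsum C h1 a) rho / 2.
    rewrite (@eq_wskew _ C _ _ (rcons a 0%N) _ (rcons (nseq p 0%N) 1%N)) //.
    rewrite wskew_rcons ?size_nseq // /wskew skew_sum_eq0.
      by rewrite -/rho; ring.
    by move=> k _; rewrite /weight nth_nseq if_same.
  (* The weights at the merge are (x, 0, 0) and (0, 1, 0), with determinant x. This matches half of
     (x rho, rho), as rho has norm 2. *)
  rewrite [local_intersection _ _ _ _ _]/= det3E /weight /= !new1 !nth_rcons.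
  rewrite !size_rcons size_nseq sa !ltnn !eqxx ltnSn !(nth_all0 _ zero0).
  rewrite qformDl qformZl rho2.
  by field.
have {}iN := iN jN.
have [a [x [sa ef eK eK1]]] := cyc i iN.
have [a' [x' [sa' ef' eK' eK1']]] := cyc j jN.
rewrite !etri // eK1 eK1'.
rewrite (eMN _ _ _ iN sa eK) (eMN _ _ _ jN sa' eK').
rewrite (eQ _ _ _ iN sa ef) (eQ _ _ _ jN sa' ef').
rewrite (_ : skew_sum _ _ _ _ _ = skew_sum C (N b0) (one_sub_A (size b0) om0 i)
    (one_sub_A (size b0) om0 j) (solid_merge_root C b0)); last first.
  by apply: eq_skew_sum => k kN; rewrite ?eM ?eR.
rewrite -IH4 ?ij // wskew_rcons0 // !(qformDl, qformZl) rho2.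
have [_ _] := weave_braid Cdiag Csym wmu nmu (slus (tri_index om0 i))
  (slus (tri_index om0 j)).
rewrite ef ef' wskew_rcons // -/rho => <-.
rewrite cycle_intersection_rcons -/K !om1K eK eK' eK1 eK1'.
rewrite cycle_intersection_cat ?tri // !(lusztig_weave _ wv).2 //.
rewrite (flow_intersection_rcons0 wmu) //.
have -> : cycle_intersection (size b0).+1 om0 (tri_index om0 i) (tri_index om0 j)
    = cycle_intersection (size b0) om0 (tri_index om0 i) (tri_index om0 j).
  apply: eq_bigr => t _.
  apply: eq_local_intersection => k;
    by rewrite (lusztig_weave _ wv).2 ?nth_rcons0 // ltnW.
(* For two old cycles the weights (x, 0, 0) and (x', 0, 0) are proportional, so the merge
   contributes 0. The boundary terms lost with x and x' are those of the new coordinates -x and -x',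
   and the two products x x' cancel. *)
rewrite [local_intersection _ _ _ _ _]/= det3E /weight /= !nth_rcons.
rewrite !size_rcons sa sa' !ltnn !eqxx ltnSn.
by field.
Qed.

End RightInductive.

(** * Compatibility *)

Lemma sgr_natB (k l : nat) : Num.sg (l%:R - k%:R : rat)
  = if (k < l)%N then 1 else if (l < k)%N then -1 else 0.
Proof.
case: ltngtP => [kl|lk|->]; last by rewrite subrr sgr0.
  by apply/eqP; rewrite sgr_cp0 subr_gt0 ltr_nat.
by apply/eqP; rewrite sgr_cp0 subr_lt0 ltr_nat.
Qed.

Section Unitriangular.

Variables (N : nat) (V : 'M[rat]_N).
Hypotheses (Vdiag : forall i, V i i = 1)
           (Vlow : forall i j : 'I_N, (j < i)%N -> V i j = 0).

Lemma unitriangular_unit : V \in unitmx.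
Proof.
rewrite unitmxE -det_tr det_trig; last first.
  by apply/is_trig_mxP => i j ij; rewrite mxE Vlow.
by rewrite big1 ?unitr1 // => i _; rewrite mxE Vdiag.
Qed.

(** In entry (i, j) of V^-1 V = 1, the terms k > j vanish by triangularity and the terms k < j by
    induction on the column, which leaves the wanted entry times V_jj = 1. *)
Lemma unitriangular_inv (i j : 'I_N) : (j < i)%N -> invmx V i j = 0.
Proof.
have [m] := ubnP (nat_of_ord j); elim: m j => // m IH j jm ji.
have /matrixP/(_ i j) := mulVmx unitriangular_unit.
rewrite !mxE -val_eqE gtn_eqF // (bigD1 j) //= Vdiag mulr1 big1 ?addr0 // => k kj.
have [kj'|jk] := ltnP k j; last by rewrite Vlow ?mulr0 // ltn_neqAle eq_sym kj.
by rewrite IH ?mul0r //; [apply: leq_trans kj' _ | apply: ltn_trans kj' _].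
Qed.

(* [G] is the Gram matrix of a family [e] with [e *m V] having Gram matrix
   [V + V^T]. *)
Lemma gram_half (G L : 'M[rat]_N) :
    V^T *m G *m V = V + V^T ->
    (forall i j : 'I_N, L i j = Num.sg (j%:R - i%:R) * G i j) ->
  L = invmx V - (invmx V)^T.
Proof.
move=> eG eL; have uV := unitriangular_unit.
have uVT : V^T \in unitmx by rewrite unitmx_tr.
have {}eG : G = (invmx V)^T + invmx V.
  rewrite -[G](mulKmx uVT) -[V^T *m G](mulmxK uV) eG mulmxDl mulmxV // mulmxDr.
  by rewrite mulmx1 mulmxA mulVmx // mul1mx trmx_inv.
(* Above the diagonal only [invmx V] contributes to [G], below it only the transpose, so the sign
   turns their sum into their difference. *)
apply/matrixP => i j; rewrite eL eG !mxE sgr_natB.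
have [ij|ji|/val_inj ->] := ltngtP i j.
- by rewrite (unitriangular_inv ij); ring.
- by rewrite (unitriangular_inv ji); ring.
by rewrite subrr mul0r.
Qed.

End Unitriangular.

(* On the radical of [V + V^T], the form [V - V^T] is [2 V = - 2 V^T]. *)
Lemma compatible_row N (V M : 'M[rat]_N) (m : 'rV[rat]_N) :
    V \in unitmx -> M \in unitmx -> m *m (V + V^T) = 0 ->
  2^-1 *: (m *m (V - V^T) *m M^T)
    *m ((invmx M)^T *m (invmx V - (invmx V)^T) *m invmx M)
  = 2 *: (m *m invmx M).
Proof.
move=> uV uM m0; have uVT : V^T \in unitmx by rewrite unitmx_tr.
have e0 : m *m V^T = - (m *m V) by apply/esym/addr0_eq; rewrite -mulmxDr.
have -> : m *m (V - V^T) = 2 *: (m *m V).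
  by rewrite mulmxBr e0 opprK scaler_nat mulr2n.
rewrite -!scalemxAl scalerA mulVf // scale1r !mulmxA -(mulmxA _ M^T) -trmx_mul.
rewrite mulVmx // trmx1 mulmx1 mulmxBr mulmxK // trmx_inv.
rewrite -[m *m V]opprK -e0 mulNmx mulmxK // opprK -mulr2n scaler_nat.
by rewrite mulmxDl -mulr2n.
Qed.

(** * The matrices of a right inductive weave in terms of V and M *)

Section Main.

Variables (n : nat) (C : 'M[int]_n).
Hypotheses (Cdiag : forall i, C i i = 2) (Csym : C^T = C).
Variables (b : seq 'I_n) (om : seq vertex) (h : seq 'I_n).
Hypothesis hom : right_inductive C b om h.

(** As C is symmetric, coroots and roots have the same coordinates and the pairing is the invariant
    form. *)
Lemma boundary_intersectionE c c' :
  boundary_intersection C h c c' = wskew C h c c'.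
Proof.
rewrite /boundary_intersection /wskew /skew_sum; congr (_ / _).
apply: eq_bigr => k _; apply: eq_bigr => l _; congr (_ * _).
by rewrite (qformC Csym) /qroot qform_map /pairing /word_coroot Csym.
Qed.

Let N := nV om.
Let R := solid_merge_root C b.
Let M : 'M[rat]_N := 1%:M - A_matrix b om.
Let V : 'M[rat]_N :=
  \matrix_(i, j) if (i < j)%N then qform C (R i) (R j) else (i == j)%:R.

Lemma size_solids : size (solids C b) = N.
Proof. by have [_ <- _ _] := right_inductive_cycles Cdiag Csym hom. Qed.

Lemma ME i j : M i j = one_sub_A (size b) om i j.
Proof. by rewrite !mxE. Qed.

Lemma unitmx_M : M \in unitmx.
Proof.
apply: unitriangular_unit => [i|i j ji]; rewrite ME /one_sub_A.
  by rewrite eqxx ltnn subr0.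
by rewrite gtn_eqF // ltnNge ltnW // subr0.
Qed.

Lemma Vdiag i : V i i = 1.
Proof. by rewrite mxE ltnn eqxx. Qed.

Lemma Vlow (i j : 'I_N) : (j < i)%N -> V i j = 0.
Proof. by move=> ji; rewrite mxE ltnNge ltnW // -val_eqE gtn_eqF. Qed.

Lemma gram_R i j : (V + V^T) i j = qform C (R i) (R j).
Proof.
rewrite !mxE -!val_eqE; have [ij|ji|/val_inj ->] := ltngtP i j.
- by rewrite addr0.
- by rewrite add0r (qformC Csym).
by rewrite /R qform_solid_merge_root // size_solids.
Qed.

Lemma skew_R i j :
  (V - V^T) i j = Num.sg (j%:R - i%:R) * qform C (R i) (R j).
Proof.
rewrite !mxE -!val_eqE sgr_natB; have [ij|ji|/val_inj ->] := ltngtP i j.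
- by rewrite subr0 mul1r.
- by rewrite sub0r mulN1r (qformC Csym).
by rewrite subrr mul0r.
Qed.

Lemma L_matrixE : L_matrix C b om = invmx V - (invmx V)^T.
Proof.
pose eta := solid_word_root C b.
apply: (@gram_half _ _ Vdiag Vlow (\matrix_(i, j) qform C (eta i) (eta j))).
  apply/matrixP => i j; rewrite gram_R.
  (* The expansion over l < k extends to all l: the diagonal of V gives the leading term and the
     entries below it are 0. *)
  have RE (k : 'I_N) : R k = - \sum_(l < N) V l k *: eta l.
    rewrite /R (solid_merge_root_expand Cdiag Csym) ?size_solids //; congr (- _).
    rewrite (bigD1 k) //= Vdiag scale1r; congr (_ + _).
    pose F l := qform C (solid_merge_root C b l) (solid_merge_root C b k)
      *: solid_word_root C b l.
    rewrite (big_ord_widen N F (ltnW (ltn_ord k))).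
    rewrite [RHS](bigID (fun l : 'I_N => (l < k)%N)) /= [X in _ + X]big1 ?addr0.
      apply: eq_big => [l|l lk]; last by rewrite mxE lk.
      by rewrite -val_eqE /=; case: ltngtP.
    move=> l /andP[lk nlk]; rewrite Vlow ?scale0r // ltn_neqAle leqNgt nlk.
    by rewrite val_eqE eq_sym lk.
  rewrite !RE qformNl qformNr opprK qform_sumr mxE; apply: eq_bigr => l _.
  rewrite qformZr mulrC qform_suml [(V^T *m _) i l]mxE; congr (_ * _).
  apply: eq_bigr => k _.
  by rewrite qformZl [V^T i k]mxE [(\matrix_(_, _) _) k l]mxE.
(* [lambda_form] compares word positions while [gram_half] compares indices; the signs agree because
   the solid positions increase. *)
have sol_mono := sorted_ltn_nth ltn_trans 0%N.
move=> i j; rewrite !mxE /lambda_form -qform_map; congr (_ * _).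
have so : sorted ltn (solids C b).
  by apply: sorted_filter (iota_ltn_sorted _ _); apply: ltn_trans.
have lt k l : (k < N)%N -> (l < N)%N -> (k < l)%N ->
    (nth 0%N (solids C b) k < nth 0%N (solids C b) l)%N.
  by move=> kN lN; apply: sol_mono => //; rewrite inE size_solids.
rewrite !sgr_natB; have [ij|ji|/val_inj->] := ltngtP i j; last by rewrite ltnn.
  by rewrite (lt i j).
have ji' := lt j i (ltn_ord j) (ltn_ord i) ji.
by rewrite ji' ltnNge ltnW.
Qed.

Lemma epsilonE (i j : 'I_N) :
  epsilon C b h i j = (2^-1 *: (M *m (V - V^T) *m M^T)) i j.
Proof.
have [_ _ _] := right_inductive_cycles Cdiag Csym hom; rewrite size_solids => H.
pose c k := lusztig (size b) om (tri_index om k) (size om).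
pose o k := one_sub_A (size b) om k.
have -> : (2^-1 *: (M *m (V - V^T) *m M^T)) i j = skew_sum C N (o i) (o j) R.
  rewrite mxE mulrC mxE /skew_sum exchange_big; congr (_ / _).
  apply: eq_bigr => l _; rewrite [M^T l j]mxE [(M *m _) i l]mxE mulr_suml.
  by apply: eq_bigr => k _; rewrite skew_R !ME /o; ring.
have -> : epsilon C b h i j
    = cycle_intersection (size b) om (tri_index om i) (tri_index om j)
      + wskew C h (c i) (c j).
  by rewrite /epsilon boundary_intersectionE.
(* The induction covers i < j. The opposite case follows by antisymmetry of both sides, and on the
   diagonal both vanish. *)
have [ij|ji|->] := ltngtP i j.
- by apply: H; rewrite ij ltn_ord.
- rewrite cycle_intersection_anti /wskew skew_sum_anti // -opprD.
  by rewrite [RHS]skew_sum_anti // -H ?ji ?ltn_ord.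
have self0 (x : rat) : x = - x -> x = 0 by lra.
rewrite (self0 _ (cycle_intersection_anti _ _ _ _)).
by rewrite (self0 _ (skew_sum_anti Csym _ _ _ _)) /wskew
  (self0 _ (skew_sum_anti Csym _ _ _ _)) addr0.
Qed.

(** All bottom weights of the cycle are 0, hence so is its bottom vector, the sum of the M_vj R_j.
    Pairing this zero vector with each R_l gives the row. *)
Lemma exchangeable_radical v : v \in exchangeable b om ->
  row v M *m (V + V^T) = 0.
Proof.
rewrite inE => /(all_nthP 0%N) v0.
have [_ _ + _] := right_inductive_cycles Cdiag Csym hom.
move=> /(_ v); rewrite size_solids => /(_ (ltn_ord v)).
rewrite /wsum qsum_eq0 => [/esym m0|k kh]; last first.
  rewrite /weight; apply/eqP; rewrite pnatr_eq0.
  have [ks|ks] := ltnP k (size (lusztig (size b) om (tri_index om v) (size om))).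
    exact: v0.
  by rewrite nth_default.
apply/rowP => l; rewrite mxE [RHS]mxE; rewrite -[RHS](qform0l C (R l)).
rewrite -[X in qform _ X]m0 /qsum qform_suml.
by apply: eq_bigr => k _; rewrite gram_R qformZl [row _ _ _ _]mxE ME.
Qed.

(** Skewness converts the summation form of compatibility into the product of -Lambda with B. *)
Lemma Lambda_skew : (Lambda_matrix C b om)^T = - Lambda_matrix C b om.
Proof.
have LT : (L_matrix C b om)^T = - L_matrix C b om.
  by rewrite L_matrixE linearB /= trmxK opprB.
by rewrite /Lambda_matrix !trmx_mul trmxK LT mulNmx mulmxN mulmxA.
Qed.

Lemma exchange_row (v : 'I_#|exchangeable b om|) (w : 'I_N) :
  \sum_u exchange_matrix C b om h u v * Lambda_matrix C b om u w
  = 2 * (enum_val v == w)%:R.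
Proof.
have rad := exchangeable_radical (enum_valP v).
have uV := unitriangular_unit Vdiag Vlow.
have := compatible_row uV unitmx_M rad.
rewrite -[invmx V - _]L_matrixE -[_^T *m _ *m _]/(Lambda_matrix C b om).
(* The vector m of [compatible_row] is row v of M, so m M^-1 is the unit row e_v. Column v of the
   exchange matrix is row v of epsilon. *)
rewrite -(row_mul _ M (invmx M)) mulmxV ?unitmx_M // -!row_mul => /rowP/(_ w).
rewrite mxE [RHS]mxE [row _ 1%:M _ _]mxE [1%:M _ _]mxE => <-.
by apply: eq_bigr => u _; rewrite mxE epsilonE !mxE.
Qed.

End Main.

Theorem proposition8p3 (n : nat) (C : 'M[int]_n)
    (hC : simply_laced_finite_type C)
    (b : seq 'I_n) (om : seq vertex) (h : seq 'I_n)
    (hom : right_inductive C b om h) :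
  compatible_pair (Lambda_matrix C b om) (exchange_matrix C b om h) /\
  forall (u : 'I_(nV om)) (v : 'I_#|exchangeable b om|),
    (- Lambda_matrix C b om *m exchange_matrix C b om h) u v
    = 2 * (u == enum_val v)%:R.
Proof.
have [Cdiag _ Csym _] := hC.
have ex := exchange_row Cdiag Csym hom.
split=> [//|u v]; rewrite eq_sym -ex -(Lambda_skew Cdiag Csym hom) mxE.
by apply: eq_bigr => w _; rewrite mulrC [_^T _ _]mxE.
Qed.
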